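(* If a convergence $\xi$ has countable pseudopaving number, then $\mathrm{P}_1\xi=\mathrm{S}_0\xi$. In particular, a convergence that is countably deep and has countable pseudopaving number is a pretopology.
   Context: Filters on $X$ are families of nonempty subsets closed under finite intersections and supersets, ordered by inclusion ($\leq$); $\bigwedge$ is intersection. Two families of sets mesh, $\mathcal{A}\#\mathcal{B}$, if $A\cap B\neq\emptyset$ for all $A\in\mathcal{A},B\in\mathcal{B}$. A convergence $\xi$ on $X$ is a relation between points and filters, written $x\in\lim_\xi\mathcal{F}$, such that $x\in\lim_\xi\{x\}^{\uparrow}$ for all $x$ (where $\{x\}^\uparrow$ is the principal ultrafilter of $x$), and $\mathcal{F}\subset\mathcal{G}$ implies $\lim_\xi\mathcal{F}\subset\lim_\xi\mathcal{G}$. The adherence of a filter $\mathcal{H}$ is $\mathrm{adh}_\xi\mathcal{H}=\bigcup_{\mathcal{F}\#\mathcal{H}}\lim_\xi\mathcal{F}$ (union over filters $\mathcal{F}$ on $X$). $\mathrm{S}_0\xi$ is the convergence with $\lim_{\mathrm{S}_0\xi}\mathcal{F}=\bigcap\{\mathrm{adh}_\xi\mathcal{D}:\mathcal{D}\text{ principal filter},\ \mathcal{D}\#\mathcal{F}\}$ (a principal filter consists of all supersets of a nonempty set). $\xi$ is a pretopology if $\xi=\mathrm{S}_0\xi$. $\mathrm{P}_1\xi$ is the convergence given by: $x\in\lim_{\mathrm{P}_1\xi}\mathcal{F}$ iff there is a countable set $\mathbb{D}$ of filters, each converging to $x$ for $\xi$, with $\mathcal{F}\geq\bigwedge_{\mathcal{D}\in\mathbb{D}}\mathcal{D}$.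 $\xi$ is countably deep if $\lim_\xi\bigwedge_{\mathcal{F}\in\mathbb{A}}\mathcal{F}=\bigcap_{\mathcal{F}\in\mathbb{A}}\lim_\xi\mathcal{F}$ for every nonempty countable set $\mathbb{A}$ of filters on $X$. A pseudopavement at $x$ is a family $\mathbb{D}$ of filters, each converging to $x$, such that every ultrafilter converging to $x$ contains some $\mathcal{D}\in\mathbb{D}$. $\mathsf{pp}(\xi,x)$ is the least cardinality of a pseudopavement at $x$, and $\mathsf{pp}(\xi)=\sup_{x\in X}\mathsf{pp}(\xi,x)$ is the pseudopaving number; it is countable if $\mathsf{pp}(\xi)\leq\omega$. *)

(* Defs.v *)
From HB Require Import structures.
From mathcomp Require Import all_boot.
From mathcomp Require Import boolp classical_sets functions cardinality filter.

Set Implicit Arguments.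
Unset Strict Implicit.
Unset Printing Implicit Defensive.

Local Open Scope classical_set_scope.
Local Open Scope card_scope.

(* A filter is a [ProperFilter]; [clim] is empty on the set systems that are
   not filters, so that equality of convergences is equality of relations
   between points and filters. *)
Record convergence (X : Type) := Convergence {
  clim : set_system X -> set X ;
  clim_filter : forall F x, clim F x -> ProperFilter F ;
  clim_point : forall x, clim (principal_filter x) x ;
  clim_le : forall F G, ProperFilter F -> ProperFilter G ->
    F `<=` G -> clim F `<=` clim G }.

Lemma convergence_eq (X : Type) (xi zeta : convergence X) :
  (forall F, clim xi F = clim zeta F) -> xi = zeta.
Proof.
case: xi => l a b c; case: zeta => l' a' b' c' /= /funext ll'.
by case: _ / ll' in a' b' c' *; congr Convergence; exact: Prop_irrelevance.
Qed.

Definition adherence (X : Type) (xi : convergence X) (H : set_system X) :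
    set X :=
  \bigcup_(F in [set F | ProperFilter F /\ F `#` H]) clim xi F.

(* [globally A] is the family of all supersets of [A]. *)
Definition is_principal (X : Type) (D : set_system X) : Prop :=
  exists2 A : set X, A !=set0 & D = globally A.

Section Modifications.
Variables (X : Type) (xi : convergence X).

Definition S0_lim (F : set_system X) : set X :=
  [set x | ProperFilter F /\
    (\bigcap_(D in [set D | is_principal D /\ D `#` F]) adherence xi D) x].

Fact S0_lim_filter F x : S0_lim F x -> ProperFilter F.
Proof. by case. Qed.

Fact S0_lim_point x : S0_lim (principal_filter x) x.
Proof.
split=> [|D [_ Dx]]; first exact: principal_filter_proper.
exists (principal_filter x); last exact: clim_point.
by split; [exact: principal_filter_proper|rewrite meetsC].
Qed.

Fact S0_lim_le F G : ProperFilter F -> ProperFilter G ->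
  F `<=` G -> S0_lim F `<=` S0_lim G.
Proof.
move=> _ PG FG x [_ Fx]; split=> // D [pD DG]; apply: Fx; split=> //.
by apply: sub_meets DG.
Qed.

Definition S0 : convergence X :=
  Convergence S0_lim_filter S0_lim_point S0_lim_le.

(* The intersection of the empty family is the full powerset, which no filter
   contains; hence only nonempty [DD] matter here. *)
Definition P1_lim (F : set_system X) : set X :=
  [set x | ProperFilter F /\
    exists DD : set (set_system X), [/\ countable DD,
      (forall D, DD D -> clim xi D x) & \bigcap_(D in DD) D `<=` F]].

Fact P1_lim_filter F x : P1_lim F x -> ProperFilter F.
Proof. by case. Qed.

Fact P1_lim_point x : P1_lim (principal_filter x) x.
Proof.
split; first exact: principal_filter_proper.
exists [set principal_filter x]; split.
- exact: countable1.
- by move=> D ->; exact: clim_point.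
- by rewrite bigcap_set1.
Qed.

Fact P1_lim_le F G : ProperFilter F -> ProperFilter G ->
  F `<=` G -> P1_lim F `<=` P1_lim G.
Proof.
move=> _ PG FG x [_ [DD [cDD DDx DDF]]]; split=> //.
by exists DD; split=> //; exact: subset_trans FG.
Qed.

Definition P1 : convergence X :=
  Convergence P1_lim_filter P1_lim_point P1_lim_le.

End Modifications.

Definition pretopology (X : Type) (xi : convergence X) : Prop := xi = S0 xi.

Definition countably_deep (X : Type) (xi : convergence X) : Prop :=
  forall AA : set (set_system X),
    AA !=set0 -> countable AA -> (forall F, AA F -> ProperFilter F) ->
    clim xi (\bigcap_(F in AA) F) = \bigcap_(F in AA) clim xi F.

Definition pseudopavement (X : Type) (xi : convergence X) (x : X) :
    set (set (set_system X)) :=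
  [set DD | (forall D, DD D -> clim xi D x) /\
    (forall U, UltraFilter U -> clim xi U x -> exists2 D, DD D & D `<=` U)].

(* A cardinal number is represented by a set having that cardinality. *)
Definition least_card (T : Type) (S : set (set T)) : set T :=
  xget set0 [set A | S A /\ forall B, S B -> A #<= B].

(* Cardinals are well-founded: a maximal family of choice functions on [S]
   with pairwise distinct values everywhere on [S] fills up some member of
   [S], and injects into all of them. *)
Lemma least_cardP (T : Type) (S : set (set T)) : S !=set0 ->
  S (least_card S) /\ forall B, S B -> least_card S #<= B.
Proof.
move=> [A0 SA0]; rewrite /least_card.
suff [A [SA Amin]] : exists A, S A /\ forall B, S B -> A #<= B.
  exact: (@xgetPex _ set0
    [set A | S A /\ forall B, S B -> A #<= B] (ex_intro _ A (conj SA Amin))).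
have [S0|nS0] := pselect (S set0).
  by exists set0; split=> // B _; exact: card_ge0.
have Sne A : S A -> A !=set0 by move=> SA; apply/set0P/eqP => A0'; rewrite A0' in SA.
have [t0 _] := Sne _ SA0.
pose ok (F : set (set T -> T)) :=
  (forall g, F g -> forall A, S A -> A (g A)) /\
  (forall g h A, F g -> F h -> S A -> g A = h A -> g = h).
have [|F [[Fch Finj] Fmax]] := @Zorn_bigcup _ ok.
  move=> C Cok Ctot; split=> [g [F CF Fg]|g h A [F CF Fg] [G CG Gh] SA].
    by have [+ _] := Cok _ CF; apply.
  have [FG|GF] := Ctot _ _ CF CG.
    by have [_ +] := Cok _ CG => /(_ g h A); apply=> //; exact: FG.
  by have [_ +] := Cok _ CF => /(_ g h A); apply=> //; exact: GF.
have [A SA Asurj] : exists2 A, S A & A `<=` [set g A | g in F].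
  apply: contrapT => noA.
  have /choice[k kP] : forall A, exists t, S A -> A t /\ ~ [set g A | g in F] t.
    move=> A; have [SA|nSA] := pselect (S A); last by exists t0.
    have : ~ A `<=` [set g A | g in F] by move=> ?; apply: noA; exists A.
    by move=> /existsNP[t /not_implyP[At nt]]; exists t.
  have nFk : ~ F k by move=> Fk; have [_ []] := kP _ SA0; exists k.
  have FkF : F `<` F `|` [set k].
    by split; [left|move=> /(_ k (or_intror erefl))].
  have kout B g : S B -> F g -> g B <> k B.
    by move=> SB Fg e; have [_ []] := kP _ SB; exists g.
  apply: (Fmax _ FkF); split=> [g [Fg|->] B SB|].
  - exact: (Fch g Fg B SB).
  - by have [] := kP _ SB.
  - move=> g h B [Fg|->] [Fh|->] SB // e; first exact: Finj e.
    + by case: (kout _ _ SB Fg).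
    + by case: (kout _ _ SB Fh).
exists A; split=> // B SB.
apply: (@card_le_trans _ _ _ F).
  exact: card_le_trans (subset_card_le Asurj) (card_image_le (fun g => g A) F).
have injB : {in F &, injective (fun g : set T -> T => g B)}.
  by move=> g h /set_mem Fg /set_mem Fh; exact: Finj.
rewrite -(card_le_eql (inj_card_eq injB)); apply: subset_card_le.
by move=> _ [g Fg <-]; exact: (Fch g Fg B SB).
Qed.

Definition pp_at (X : Type) (xi : convergence X) (x : X) :
    set (set_system X) :=
  least_card (pseudopavement xi x).

(* The supremum may be taken among the cardinalities of sets of set systems,
   since all the [pp_at xi x] are bounded by that of [setT]. *)
Definition pp (X : Type) (xi : convergence X) : set (set_system X) :=
  least_card [set K | forall x, pp_at xi x #<= K].

(* Main.v *)
Require Import Defs.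
From mathcomp Require Import all_boot.
From mathcomp Require Import boolp classical_sets functions cardinality filter.

(** If [x] is a limit of [F] for [S0 xi] and [B] belongs to every member of a
pseudopavement at [x] but not to [F], then the complement of [B] meshes with
[F], so it belongs to an ultrafilter converging to [x]; that ultrafilter
refines some member of the pseudopavement and hence contains [B] as well.
Therefore any countable pseudopavement at [x] witnesses convergence to [x]
for [P1 xi]. *)

Local Open Scope classical_set_scope.
Local Open Scope card_scope.

Lemma meets_globally_setC (T : Type) (F : set_system T) (B : set T) :
  Filter F -> globally (~` B) `#` F <-> ~ F B.
Proof.
move=> FF; rewrite meets_globallyl; split=> [BF /BF[t []]//|nFB A FA].
apply/set0P/eqP => BA0; apply: nFB; apply: filterS FA => t At.
by apply: contrapT => nBt; have : set0 t by rewrite -BA0.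
Qed.

(** The trace [within A F] contains [F] and [A], and meshing makes it proper; any ultrafilter finer
    than it will do. *)
Lemma meets_globally_ultra (T : Type) (F : set_system T) (A : set T) :
  Filter F -> F `#` globally A -> exists U, [/\ UltraFilter U, F `<=` U & U A].
Proof.
move=> FF; rewrite meets_globallyr => FA.
have PW : ProperFilter (within A F).
  by apply: Build_ProperFilter; rewrite /within /= => /FA[t [/[apply]]].
have [U [UU WU]] := ultraFilterLemma PW.
exists U; split=> //; last exact: WU (withinT A FF).
exact: subset_trans (cvg_within A) WU.
Qed.

Section Modifications.
Context {X : Type}.
Implicit Types (xi : convergence X) (F : set_system X) (x : X).

(** Ensures that pseudopavements exist, so that [pp_at] is a true minimum and not the default value
    of [least_card]. *)
Lemma pseudopavement_clim xi x : pseudopavement xi x (clim xi ^~ x).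
Proof. by split=> [//|U UU Ux]; exists U. Qed.

Lemma pp_at_pseudopavement xi x : pseudopavement xi x (pp_at xi x).
Proof.
have pp0 : pseudopavement xi x !=set0.
  by exists (clim xi ^~ x); exact: pseudopavement_clim.
by have [] := least_cardP pp0.
Qed.

Lemma pp_at_le xi x : pp_at xi x #<= pp xi.
Proof.
have ppT : [set K : set (set_system X) | forall y, pp_at xi y #<= K] !=set0.
  (* The full set bounds every [pp_at xi y], so the supremum is taken over a nonempty set of
     bounds. *)
  by exists setT => y; exact: subset_card_le.
have [ppP _] := least_cardP ppT; exact: ppP.
Qed.

(** If [A] meshes with [F], its complement is not in [F], so it is missing from some [D] in the
    witnessing family; this [D] meshes with [A] and puts [x] in the adherence. *)
Lemma P1_sub_S0 xi F : clim (P1 xi) F `<=` clim (S0 xi) F.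
Proof.
move=> x [PF [DD [_ DDx DDF]]]; split=> // _ [[A A0 ->] AF].
apply: contrapT => nadh.
have : ~ F (~` A) by apply/meets_globally_setC; rewrite setCK.
apply; apply: DDF => D DDD; apply: contrapT => nDA.
have PD := clim_filter (DDx _ DDD).
apply: nadh; exists D; last exact: DDx.
by split=> //; rewrite meetsC -(setCK A); apply/meets_globally_setC.
Qed.

Lemma S0_pseudopavement xi F x (DD : set (set_system X)) :
  clim (S0 xi) F x -> pseudopavement xi x DD -> \bigcap_(D in DD) D `<=` F.
Proof.
move=> [PF Fx] [_ DDU] B DDB; apply: contrapT => nFB.
have BF : globally (~` B) `#` F by apply/meets_globally_setC.
(* A principal filter needs a nonempty base; meshing with [setT] provides the point. *)
have B0 : ~` B !=set0.
  by move: BF; rewrite meets_globallyl => /(_ setT filterT); rewrite setIT.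
have [G [PG GB] Gx] : adherence xi (globally (~` B)) x.
  by apply: Fx; split=> //; exists (~` B).
have [U [UU GU UB]] := meets_globally_ultra _ _ _ _ GB.
have [D DDD DU] := DDU U UU (clim_le PG ultra_proper GU Gx).
apply: (filter_not_empty U); rewrite -(setICr B).
by apply: filterI => //; apply: DU; exact: DDB.
Qed.

Lemma P1_S0 xi : countable (pp xi) -> P1 xi = S0 xi.
Proof.
move=> cpp; apply: convergence_eq => F; apply/seteqP; split.
  exact: P1_sub_S0.
move=> x Fx; have ppx := pp_at_pseudopavement xi x.
split; first exact: clim_filter Fx.
exists (pp_at xi x); split; last exact: S0_pseudopavement Fx ppx.
- exact: sub_countable (pp_at_le xi x) cpp.
- by case: ppx.
Qed.

(** Depth makes the intersection of a countable witnessing family converge to [x], and [F] is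
    finer. *)
Lemma P1_countably_deep xi : countably_deep xi -> P1 xi = xi.
Proof.
move=> deep; apply: convergence_eq => F; apply/seteqP; split=> x.
  move=> [PF [DD [cDD DDx DDF]]].
  (* An empty family would intersect to the full powerset and put [set0] in [F]. *)
  have DD0 : DD !=set0.
    apply/set0P/eqP => DD0; apply: (filter_not_empty F).
    by apply: DDF; rewrite DD0 bigcap_set0.
  have DDlim : clim xi (\bigcap_(D in DD) D) x.
    by rewrite (deep DD DD0 cDD (fun D DDD => clim_filter (DDx D DDD))).
  by apply: (clim_le _ _ DDF) => //; exact: clim_filter DDlim.
move=> Fx; split; first exact: clim_filter Fx.
exists [set F]; split=> [|D ->//|]; first exact: countable1.
by rewrite bigcap_set1.
Qed.

End Modifications.

Theorem proposition82 (X : Type) :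
  (forall xi : convergence X, countable (pp xi) -> P1 xi = S0 xi) /\
  (forall xi : convergence X,
    countably_deep xi -> countable (pp xi) -> pretopology xi).
Proof.
split=> xi; first exact: P1_S0.
by move=> deep /P1_S0 PS; rewrite /pretopology -PS P1_countably_deep.
Qed.
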